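(* Let $n\ge 1$ and $1\le k\le n$ be integers. Suppose that there is a shape-preserving injection $f: I_{n,k-1}\times I_{n,k+1}\to I_{n,k}^2$. Then there is a shape-preserving injection $F: L_{n,k-1}\times L_{n,k+1}\to L_{n,k}^2$.
   Context: $\mathfrak S_n$ is the symmetric group of all permutations of $[n]=\{1,\dots,n\}$, written in one-line notation, and $\mathfrak I_n\subseteq\mathfrak S_n$ is the set of involutions, i.e. permutations whose square is the identity. For $\pi\in\mathfrak S_n$, $\ell(\pi)$ denotes the length of a longest increasing subsequence of $\pi$. Put $L_{n,k}=\{\pi\in\mathfrak S_n : \ell(\pi)=k\}$ and $I_{n,k}=\{\pi\in\mathfrak I_n : \ell(\pi)=k\}$. For a set $X$, $X^2=X\times X$. The Robinson–Schensted correspondence is the standard bijection from $\mathfrak S_n$ to pairs $(P,Q)$ of standard Young tableaux with $n$ cells and of the same shape. The shape $\operatorname{sh}\pi$ of a permutation $\pi$ is the common shape (a partition of $n$) of the two tableaux $P,Q$ corresponding to $\pi$. For a pair of permutations, $\operatorname{sh}(\pi,\sigma)=(\operatorname{sh}\pi,\operatorname{sh}\sigma)$. A map $F: L_{n,k-1}\times L_{n,k+1}\to L_{n,k}^2$ is called shape preserving if for all $(\pi,\pi'),(\sigma,\sigma')$ in its domain, $\operatorname{sh}(\pi,\pi')=\operatorname{sh}(\sigma,\sigma')$ implies $\operatorname{sh}F(\pi,\pi')=\operatorname{sh}F(\sigma,\sigma')$. The same terminology is used for maps $f: I_{n,k-1}\times I_{n,k+1}\to I_{n,k}^2$. *)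

(* Defs.v *)
From HB Require Import structures.
From mathcomp Require Import all_boot all_fingroup.

Set Implicit Arguments.
Unset Strict Implicit.
Unset Printing Implicit Defensive.

Local Open Scope nat_scope.

(* Positions, values and tableau entries all range over {0, ..., n-1} rather  *)
(* than {1, ..., n}: a permutation s : 'S_n has one-line notation             *)
(* s 0, s 1, ..., s (n-1).                                                    *)

Definition incr_on (n : nat) (s : 'S_n) (A : {set 'I_n}) : bool :=
  [forall i in A, forall j in A, (i < j) ==> (s i < s j)].

Definition lis (n : nat) (s : 'S_n) : nat :=
  \max_(A : {set 'I_n} | incr_on s A) #|A|.

(* A tableau is the sequence of its rows, from top to bottom. *)
Definition tableau := seq (seq nat).

(* Schensted row insertion of x: the result is the new tableau together with  *)
(* the index of the row that acquired a new cell.  In each row x replaces the *)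
(* leftmost entry greater than x, which is then inserted into the next row;   *)
(* when there is no such entry, find returns size r and set_nth appends x.    *)
Fixpoint rs_insert (T : tableau) (x : nat) : tableau * nat :=
  if T is r :: T' then
    let i := find (fun y => x < y) r in
    let r' := set_nth 0 r i x in
    if i < size r then
      let U := rs_insert T' (nth 0 r i) in (r' :: U.1, U.2.+1)
    else (r' :: T', 0)
  else ([:: [:: x]], 0).

(* If i = size T, this creates a new row [:: m]. *)
Definition add_to_row (T : tableau) (i m : nat) : tableau :=
  set_nth [::] T i (rcons (nth [::] T i) m).

Definition rs_step (n : nat) (s : 'S_n) (PQ : tableau * tableau) (i : 'I_n) :
    tableau * tableau :=
  let U := rs_insert PQ.1 (s i) in (U.1, add_to_row PQ.2 U.2 i).

(* The Robinson-Schensted pair (P, Q): insertion and recording tableaux. *)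
Definition RS (n : nat) (s : 'S_n) : tableau * tableau :=
  foldl (rs_step s) ([::], [::]) (enum 'I_n).

Definition sh (n : nat) (s : 'S_n) : seq nat := shape (RS s).1.

Lemma shape_rs_insert (T Q : tableau) (x m : nat) : shape T = shape Q ->
  shape (rs_insert T x).1 = shape (add_to_row Q (rs_insert T x).2 m).
Proof.
elim: T Q x => [|r T IH] [|q Q] x //= [eq_rq eqTQ].
case: ifP => [lt_ir | /negbT]; last first.
  rewrite -leqNgt => le_ri; rewrite /add_to_row /= size_rcons size_set_nth.
  have -> : find (fun y => x < y) r = size r.
    by apply/eqP; rewrite eqn_leq find_size.
  by rewrite eqTQ -eq_rq; congr (_ :: _); apply/maxn_idPl.
rewrite /add_to_row /= size_set_nth -eq_rq (IH Q _ eqTQ).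
by congr (_ :: _); apply/maxn_idPr.
Qed.

(* The two tableaux have the same shape, so sh may be read off either one. *)
Lemma shape_RS (n : nat) (s : 'S_n) : shape (RS s).1 = shape (RS s).2.
Proof.
rewrite /RS; set PQ := (X in foldl _ X); have: shape PQ.1 = shape PQ.2 by [].
elim: (enum 'I_n) PQ => [|i e IH] PQ //= eqPQ.
by apply: IH; apply: shape_rs_insert.
Qed.

Definition sh2 (n : nat) (p : 'S_n * 'S_n) : seq nat * seq nat :=
  (sh p.1, sh p.2).

Definition Lnk (n k : nat) : {set 'S_n} := [set s : 'S_n | lis s == k].

Definition Ink (n k : nat) : {set 'S_n} :=
  [set s : 'S_n | ((s * s)%g == 1%g) && (lis s == k)].

(* A map D -> E between sets of pairs is represented by a total function, of  *)
(* which only the values on D matter.                                         *)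
Definition maps_into (n : nat) (D E : {set 'S_n * 'S_n})
    (F : 'S_n * 'S_n -> 'S_n * 'S_n) : Prop :=
  forall p, p \in D -> F p \in E.

Definition shape_preserving (n : nat) (D : {set 'S_n * 'S_n})
    (F : 'S_n * 'S_n -> 'S_n * 'S_n) : Prop :=
  {in D &, forall p q, sh2 p = sh2 q -> sh2 (F p) = sh2 (F q)}.

Definition shape_preserving_injection (n : nat) (D E : {set 'S_n * 'S_n})
    (F : 'S_n * 'S_n -> 'S_n * 'S_n) : Prop :=
  [/\ maps_into D E F, {in D &, injective F} & shape_preserving D F].

(* Main.v *)
(** Every Robinson-Schensted fibre is governed by one set of recording words:
    a permutation x is determined by the pair (Q(x), Q(x^-1)), and every pair
    of recording tableaux of equal shape arises.  Involutions are the diagonal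
    pairs, so (s, t) |-> glue s t, the permutation with recording tableaux
    Q(s) and Q(t), identifies pairs of involutions of a common shape with the
    permutations of that shape.  Given f on involutions, apply it to the pair of
    involutions with tableaux (Q(p), Q(p')) and to the pair with tableaux
    (Q(p^-1), Q(p'^-1)); by shape preservation both results have the same
    shapes, and gluing them componentwise gives F(p, p').

    Both facts about Robinson-Schensted come from Fomin's growth diagrams.
    Label each edge of the n x n grid by the row in which the shape grows along
    it; the local rule computing the top and right labels of a cell from the
    bottom and left ones is invertible and symmetric under transposition.  Row
    insertion is one column of the diagram, read in increasing order of values.
    Hence the top border is Q(x), the right border is Q(x^-1), the borders
    determine x, and the rules can be run backwards from two borders with a
    common shape. *)

Require Import Defs.
From mathcomp Require Import all_boot all_fingroup zify.

Set Implicit Arguments.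
Unset Strict Implicit.
Unset Printing Implicit Defensive.

(** * Local rules of growth diagrams *)

(* [Some r]: the shape gains a cell in row r along the edge; [None]: it does
   not change. *)
Definition label := option nat.

(* From the top and right labels of a cell: whether the cell holds a point of
   the permutation, and the bottom and left labels. *)
Definition irule (a b : label) : bool * (label * label) :=
  if a == b then
    match a with
    | None => (false, (None, None))
    | Some 0 => (true, (None, None))
    | Some r.+1 => (false, (Some r, Some r))
    end
  else (false, (a, b)).

(** The forward rule. It ignores its inputs when [p] holds, so it inverts [irule] only where a point
    comes with two empty labels; stating [growth] with [irule] enforces this. *)
Definition rule (p : bool) (a b : label) : label * label :=
  if p then (Some 0, Some 0)
  else if a == b then (omap succn a, omap succn b) else (a, b).

Lemma irule_rule p a b a' b' : irule a' b' = (p, (a, b)) -> (a', b') = rule p a b.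
Proof.
rewrite /irule /rule; case: eqP => [->|/eqP ne].
  by case: b' => [[|r]|] [] *; subst => //=; rewrite eqxx.
by case=> *; subst; rewrite (negbTE ne).
Qed.

Lemma irule_sym p a b a' b' :
  irule a' b' = (p, (a, b)) -> irule b' a' = (p, (b, a)).
Proof.
rewrite /irule; case: eqP => [->|/eqP ne].
  by rewrite eqxx; case: b' => [[|r]|] [] *; subst.
by rewrite eq_sym (negbTE ne) => -[] *; subst.
Qed.

Lemma irule_point a b a' b' : irule a' b' = (true, (a, b)) ->
  [/\ a = None, b = None, a' = Some 0 & b' = Some 0].
Proof.
by rewrite /irule; case: eqP => [->|//]; case: b' => [[|r]|] [] // <- <-.
Qed.

Lemma irule_None b : irule None b = (false, (None, b)).
Proof. by case: b. Qed.

Lemma irule_None_out p b a' b' : irule a' b' = (p, (None, b)) ->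
  a' = None \/ p.
Proof. by move/irule_rule; rewrite /rule; case: p b => [] [b|] [-> _]; auto. Qed.

Lemma irule_Some_out p r b a' b' : irule a' b' = (p, (Some r, b)) -> a' <> None.
Proof. by move/irule_rule; rewrite /rule; case: p => [[->]|] //; case: eqP => _ [->]. Qed.

(** Serves to put a row on top of a tableau, which moves every label one row down. *)
Lemma irule_shift a b a' b' : irule a' b' = (false, (a, b)) ->
  irule (omap succn a') (omap succn b') = (false, (omap succn a, omap succn b)).
Proof.
have inj: injective (omap succn) by case=> [x|] [y|] // [->].
rewrite /irule (inj_eq inj); case: eqP => [->|_ [-> ->]//].
by case: b' => [[|r]|] [] // <- <-.
Qed.

(** * Growth diagrams and their borders *)

(* [H i j] labels the edge from node (i, j) to (i+1, j), and [V i j] the edge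
   from (i, j) to (i, j+1); [p i j] tells whether value j occurs at position i. *)
Definition growth (n : nat) (p : nat -> nat -> bool) (H V : nat -> nat -> label) :=
  [/\ forall i, i < n -> H i 0 = None,
      forall j, j < n -> V 0 j = None
    & forall i j, i < n -> j < n ->
      irule (H i j.+1) (V i.+1 j) = (p i j, (H i j, V i j))].

Lemma growth_sym n p H V : growth n p H V ->
  growth n (fun i j => p j i) (fun i j => V j i) (fun i j => H j i).
Proof.
by case=> H0 V0 HV; split=> // i j lti ltj; apply: irule_sym; apply: HV.
Qed.

(** From the empty bottom and left borders the forward rule fills one column after another. Vertical
    labels are covered through [growth_sym]. *)
Lemma growth_uniq n p p' H V H' V' : growth n p H V -> growth n p' H' V' ->
  (forall i j, i < n -> j < n -> p i j = p' i j) ->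
  forall i j, i < n -> j <= n -> H i j = H' i j.
Proof.
case=> H0 V0 HV [H0' V0' HV'] eqp.
have col i : i < n -> (forall j, j < n -> V i j = V' i j) ->
    forall j, j <= n -> H i j = H' i j.
  move=> lti eqV; elim=> [|j IH] lej; first by rewrite H0 ?H0'.
  have := irule_rule (HV _ _ lti lej).
  by rewrite IH 1?ltnW // eqV // eqp // -(irule_rule (HV' _ _ lti lej)) => -[].
have eqV i : i <= n -> forall j, j < n -> V i j = V' i j.
  elim: i => [|i IH] lei j ltj; first by rewrite V0 ?V0'.
  have := irule_rule (HV _ _ lei ltj).
  rewrite (col i lei (IH (ltnW lei)) j (ltnW ltj)) (IH (ltnW lei)) // eqp //.
  by rewrite -(irule_rule (HV' _ _ lei ltj)) => -[].
by move=> i j lti; apply: col => //; apply: eqV; apply: ltnW.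
Qed.

(** [irule] fills the columns from right to left, each one downwards, and reveals the points on the
    way. *)
Lemma growth_border_inj n p p' H V H' V' : growth n p H V -> growth n p' H' V' ->
  (forall i, i < n -> H i n = H' i n) -> (forall j, j < n -> V n j = V' n j) ->
  forall i j, i < n -> j < n -> p i j = p' i j.
Proof.
case=> H0 V0 HV [H0' V0' HV'] eqH eqV.
have col i : i < n -> (forall j, j < n -> V i.+1 j = V' i.+1 j) ->
    forall k, k <= n -> H i (n - k) = H' i (n - k).
  move=> lti eqVi; elim=> [|k IH] lek; first by rewrite subn0 eqH.
  have ltj: n - k.+1 < n by lia.
  have := HV _ _ lti ltj; rewrite subnSK // IH 1?ltnW // eqVi //.
  by have := HV' _ _ lti ltj; rewrite subnSK // => -> [].
have colj i : i < n -> (forall j, j < n -> V i.+1 j = V' i.+1 j) ->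
    forall j, j <= n -> H i j = H' i j.
  by move=> lti eqVi j lej; rewrite -(subKn lej); apply: col => //; lia.
have rowk k : k <= n -> forall j, j < n -> V (n - k) j = V' (n - k) j.
  elim: k => [|k IH] lek j ltj; first by rewrite subn0 eqV.
  have lti: n - k.+1 < n by lia.
  have eqVi: forall j, j < n -> V (n - k.+1).+1 j = V' (n - k.+1).+1 j.
    by rewrite subnSK //; apply: IH; apply: ltnW.
  have := HV _ _ lti ltj; rewrite eqVi // (colj _ lti eqVi) //.
  by rewrite HV' // => -[].
have eqVi i : i <= n -> forall j, j < n -> V i j = V' i j.
  by move=> lei; rewrite -(subKn lei); apply: rowk; lia.
move=> i j lti ltj; have := HV _ _ lti ltj.
by rewrite eqVi // (colj _ lti (eqVi _ lti)) // HV' // => -[].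
Qed.

(** * Partitions at the nodes *)

Definition cell (a : label) (r : nat) : nat := if a is Some x then x == r else 0.

Definition part (l : nat -> nat) := forall r, l r.+1 <= l r.

(** The two paths from the lower left to the upper right node of a square add the same cells, so
    each node carries a well-defined shape. *)
Lemma irule_cell p a b a' b' r : irule a' b' = (p, (a, b)) ->
  cell a' r + cell b r = cell a r + cell b' r.
Proof.
rewrite /irule; case: eqP => [->|_ [] *]; last by subst.
by case: b' => [[|x]|] [] *; subst => //; rewrite addnC.
Qed.

(** If [a] and [b] differ, the new shape is the union of its two neighbours; if both are [Some r],
    row [r.+1] may grow because row [r] just did; a point lengthens the first row. *)
Lemma part_forward p a b a' b' (l : nat -> nat) : irule a' b' = (p, (a, b)) ->
  part l -> part (fun r => l r + cell a r) -> part (fun r => l r + cell b r) ->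
  part (fun r => l r + cell a r + cell b' r).
Proof.
rewrite /irule; case: eqP => [->|/eqP ne].
  case: b' => [[|x]|] [_ <- <-] hl ha hb r /=.
  - by move: (hl r); lia.
  - by move: (hl r) (ha r) (ha r.+1) => /=; lia.
  - by move: (hl r); lia.
case=> _ <- <- hl ha hb r; move: (hl r) (ha r) (hb r).
case: a' b' ne {ha hb} => [x|] [y|] //=; rewrite ?addn0 //.
by rewrite (inj_eq Some_inj); lia.
Qed.

(** [m] and [v] are the shapes at the upper left and lower right nodes. If [a'] and [b'] differ, the
    lower left shape is their intersection; if both are [Some r.+1], row [r] of [m] exceeds row
    [r.+1] and can lose a cell. *)
Lemma part_backward p a b a' b' (m v : nat -> nat) : irule a' b' = (p, (a, b)) ->
  part m -> part v -> part (fun r => m r + cell a' r) ->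
  (forall r, m r + cell a' r = v r + cell b' r) ->
  [/\ part (fun r => m r - cell b r),
      forall r, m r = m r - cell b r + cell b r
    & forall r, v r = m r - cell b r + cell a r].
Proof.
rewrite /irule; case: eqP => [->|/eqP ne].
  case: b' => [[|x]|] [_ <- <-] hm hv hl e; split=> r;
    by move: (hm r) (hl r) (e r) => /=; lia.
case=> _ <- <- hm hv hl e.
have le r : cell b' r <= m r.
  move: (e r) ne; case: a' b' {hl e} => [x|] [y|] //=; last lia.
  by rewrite (inj_eq Some_inj); lia.
split=> r; last by move: (e r) (le r); lia.
  move: (hm r) (hl r) (hv r) (e r) (e r.+1) (le r) (le r.+1) ne.
  case: a' b' {hl hv e le} => [x|] [y|] //=; try lia.
  by rewrite (inj_eq Some_inj); lia.
by rewrite subnK.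
Qed.

(* Length of row r of the shape at node (i, j). *)
Definition hsum (H : nat -> nat -> label) (i j r : nat) : nat :=
  \sum_(i' < i) cell (H i' j) r.

Lemma hsumS H i j r : hsum H i.+1 j r = hsum H i j r + cell (H i j) r.
Proof. by rewrite /hsum big_ord_recr. Qed.

Lemma hsum0 H j r : hsum H 0 j r = 0.
Proof. by rewrite /hsum big_ord0. Qed.

Lemma growth_hsumr n p H V i j r : growth n p H V -> i <= n -> j < n ->
  hsum H i j.+1 r = hsum H i j r + cell (V i j) r.
Proof.
case=> _ V0 HV + ltj; elim: i => [|i IH] lei; first by rewrite !hsum0 V0.
by rewrite !hsumS IH 1?ltnW // -!addnA; congr (_ + _); rewrite addnC
  (irule_cell r (HV _ _ lei ltj)).
Qed.

Lemma growth_hsum_bot n p H V i r : growth n p H V -> i <= n -> hsum H i 0 r = 0.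
Proof.
by case=> H0 _ _ lei; rewrite /hsum big1 // => k _; rewrite H0 // (leq_trans _ lei).
Qed.

(** The shape at a node does not depend on the path to it; at the upper right corner this yields
    [sh_inv]. *)
Lemma growth_hsum_vsum n p H V i j r : growth n p H V -> i <= n -> j <= n ->
  hsum H i j r = hsum (fun j i => V i j) j i r.
Proof.
move=> g lei; elim: j => [|j IH] lej; first by rewrite (growth_hsum_bot _ g) ?hsum0.
by rewrite hsumS -IH 1?ltnW // (growth_hsumr _ g).
Qed.

Lemma growth_part n p H V i j : growth n p H V -> i <= n -> j <= n ->
  part (hsum H i j).
Proof.
move=> g; elim: i j => [|i IHi] j lei; first by move=> _ r; rewrite !hsum0.
elim: j => [|j IHj] lej; first by move=> r; rewrite !(growth_hsum_bot _ g).
have [_ _ HV] := g.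
have E r : hsum H i.+1 j.+1 r = hsum H i j r + cell (H i j) r + cell (V i.+1 j) r.
  by rewrite (growth_hsumr _ g) // hsumS.
move=> r; rewrite !E; apply: (part_forward (HV _ _ lei lej) _ _ _ r).
- by apply: IHi; apply: ltnW.
- by move=> k; rewrite -!hsumS; apply: IHj; apply: ltnW.
- by move=> k; rewrite -!(growth_hsumr _ g (ltnW lei) lej); apply: IHi => //; apply: ltnW.
Qed.

(** Together with the next lemma: the first row obeys the same recursion as the longest increasing
    subsequence in a box. *)
Lemma growth_point_hsum0 n p H V i j : growth n p H V -> i < n -> j < n ->
  p i j -> hsum H i.+1 j.+1 0 = (hsum H i j 0).+1.
Proof.
case=> H0 V0 HV lti ltj pij; have := HV _ _ lti ltj; rewrite pij.
case/irule_point=> eH eV eH' eV'.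
by rewrite (growth_hsumr _ (And3 H0 V0 HV)) // hsumS eH eV' /=; lia.
Qed.

Lemma growth_nopoint_hsum0 n p H V i j : growth n p H V -> i < n -> j < n ->
  ~~ p i j -> hsum H i.+1 j.+1 0 = maxn (hsum H i.+1 j 0) (hsum H i j.+1 0).
Proof.
case=> H0 V0 HV lti ltj /negbTE pij; have := HV _ _ lti ltj; rewrite pij.
move/irule_rule; rewrite /rule.
have g := And3 H0 V0 HV.
rewrite (growth_hsumr _ g lti ltj) hsumS (growth_hsumr _ g (ltnW lti) ltj).
case: eqP => [->|].
  by case: (V i j) => [[|r]|] [_ ->] /=; lia.
by case: (H i j) (V i j) => [[|x]|] [[|y]|] // ne [_ ->] /=; lia.
Qed.

(** * Reconstruction of a growth diagram from its top and right borders *)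

(* Here k counts the steps already made downwards from the top border, and in
   [back_col] leftwards from the right border. *)
Fixpoint back_row (h : label) (v : nat -> label) (n k : nat) : label :=
  if k is k'.+1 then (irule (back_row h v n k') (v (n - k'.+1))).2.1 else h.

Fixpoint back_col (u v : nat -> label) (n k : nat) : nat -> label :=
  if k is k'.+1 then fun j =>
    (irule (back_row (u (n - k)) (back_col u v n k') n (n - j.+1))
           (back_col u v n k' j)).2.2
  else v.

Definition backH u v n i j := back_row (u i) (back_col u v n (n - i.+1)) n (n - j).
Definition backV u v n i j := back_col u v n (n - i) j.
Definition backp u v n i j := (irule (backH u v n i j.+1) (backV u v n i.+1 j)).1.

Lemma back_irule u v n i j : i < n -> j < n ->
  irule (backH u v n i j.+1) (backV u v n i.+1 j) =
  (backp u v n i j, (backH u v n i j, backV u v n i j)).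
Proof.
move=> lti ltj; rewrite /backp.
have -> : backH u v n i j = (irule (backH u v n i j.+1) (backV u v n i.+1 j)).2.1.
  by rewrite /backH /backV -(subnSK ltj) /= subnSK // subKn 1?ltnW.
have -> : backV u v n i j = (irule (backH u v n i j.+1) (backV u v n i.+1 j)).2.2.
  by rewrite /backH /backV -(subnSK lti) /= subnSK // subKn 1?ltnW.
by case: (irule _ _) => [? []].
Qed.

(** [U] and [W] are the shapes along the top and right borders. The local rules hold by
    construction; the point is that the labels reached at the bottom and on the left are empty. *)
Lemma back_growth n (u v : nat -> label) (U W : nat -> nat -> nat) :
  (forall i, i <= n -> part (U i)) -> (forall j, j <= n -> part (W j)) ->
  (forall r, U 0 r = 0) -> (forall r, W 0 r = 0) ->
  (forall i r, i < n -> U i.+1 r = U i r + cell (u i) r) ->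
  (forall j r, j < n -> W j.+1 r = W j r + cell (v j) r) ->
  (forall r, U n r = W n r) ->
  growth n (backp u v n) (backH u v n) (backV u v n).
Proof.
move=> pU pW U0 W0 US WS UW.
set H := backH u v n; set V := backV u v n.
(* The shape at node [(i, j)]: the top shape without the labels above the node. By [good] the
   truncated subtraction is exact. *)
pose S i j r := U i r - \sum_(j <= k < n) cell (V i k) r.
have SE i j r : j < n -> S i j r = S i j.+1 r - cell (V i j) r.
  by move=> ltj; rewrite /S big_ltn // addnC subnDA.
have Sn i r : S i n r = U i r by rewrite /S big_geq // subn0.
have Hn i : H i n = u i by rewrite /H /backH subnn.
have Vn j : V n j = v j by rewrite /V /backV subnn.
(* Induction on columns from the right border, and in [col] downwards from the top: all shapes are
   partitions, and the labels are their increments. *)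
have good k : k <= n -> forall i, i = n - k ->
   (forall j, j <= n -> part (S i j)) /\
   (forall j r, j < n -> S i j.+1 r = S i j r + cell (V i j) r) /\
   (i < n -> forall j r, j <= n -> S i.+1 j r = S i j r + cell (H i j) r).
  elim: k => [|k IH] lek i ei.
    rewrite subn0 in ei; rewrite ei ltnn.
    have SW l : l <= n -> forall r, S n (n - l) r = W (n - l) r.
      elim: l => [|l IHl] lel r; first by rewrite subn0 Sn.
      have lt: n - l.+1 < n by lia.
      rewrite SE // subnSK // IHl 1?ltnW // Vn.
      by have := WS _ r lt; rewrite subnSK // => ->; rewrite addnK.
    have SWj j r : j <= n -> S n j r = W j r.
      by move=> lej; rewrite -(subKn lej) SW //; lia.
    split=> [j lej r|]; first by rewrite !SWj //; apply: pW.
    by split=> // j r ltj; rewrite !SWj ?WS ?Vn // ltnW.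
  have lti: i < n by lia.
  have [pS [SV _]] := IH (ltnW lek) i.+1 ltac:(lia).
  have col l : l <= n -> forall j, j = n - l ->
      [/\ part (S i j), forall r, S i.+1 j r = S i j r + cell (H i j) r
        & j < n -> forall r, S i j.+1 r = S i j r + cell (V i j) r].
    elim: l => [|l IHl] lel j ej.
      rewrite subn0 in ej; rewrite ej ltnn; split=> // r; rewrite !Sn.
        by apply: pU; apply: ltnW.
      by rewrite Hn US.
    have ltj: j < n by lia.
    have [pSj SHj _] := IHl (ltnW lel) j.+1 ltac:(lia).
    have [|r|P1 P2 P3] := part_backward (back_irule u v lti ltj) pSj (pS j (ltnW ltj)).
    - by move=> r; rewrite -!SHj; apply: pS.
    - by rewrite -SHj SV.
    by split=> [r|r|_ r]; rewrite !(SE i j) //; do [apply: P1 | apply: P3 | apply: P2].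
  have colj j (lej : j <= n) := col (n - j) ltac:(lia) j ltac:(lia).
  split=> [j lej|]; first by have [] := colj j lej.
  split=> [j r ltj|_ j r lej]; last by have [] := colj j lej.
  by have [_ _] := colj j (ltnW ltj); apply.
have goodi i (lei : i <= n) := good (n - i) ltac:(lia) i ltac:(lia).
have cell0 a : (forall r, cell a r = 0) -> a = None.
  by case: a => // x /(_ x) /=; rewrite eqxx.
split; last exact: back_irule.
  move=> i lti; apply: cell0 => r.
  (* The shape at the lower right corner is [U n] with all of [W n] removed, hence empty, and shapes
     only shrink to the left. *)
  have S0 i' : i' <= n -> S i' 0 r = 0.
    move=> lei'.
    have le l : l <= n -> S (n - l) 0 r = 0.
      elim: l => [|l IHl] lel.
        rewrite subn0 /S.
        have -> : \sum_(0 <= k < n) cell (V n k) r = W n r.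
          have sW m : m <= n -> \sum_(0 <= k < m) cell (V n k) r = W m r.
            elim: m => [|m IHm] lem; first by rewrite big_geq ?W0.
            by rewrite big_nat_recr //= IHm 1?ltnW // WS // Vn.
          exact: sW.
        by rewrite UW subnn.
      have lt: n - l.+1 < n by lia.
      have [_ [_ /(_ lt 0 r isT)]] := goodi _ (ltnW lt).
      by rewrite subnSK // IHl 1?ltnW //; lia.
    by rewrite -(subKn lei'); apply: le; lia.
  have [_ [_ /(_ lti 0 r isT)]] := goodi _ (ltnW lti).
  by rewrite !S0 // 1?ltnW //; lia.
move=> j ltj; apply: cell0 => r.
have [_ [/(_ j r ltj) + _]] := goodi 0 isT.
by rewrite /S !U0 !sub0n; lia.
Qed.

(** * Points in a column *)

(* Going up a column, the label can only turn nonempty at a point, and then it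
   stays nonempty. *)
Lemma growth_no_point n p H V i j : growth n p H V -> i < n -> j <= n ->
  H i j != None -> exists2 k, k < j & p i k.
Proof.
case=> H0 _ HV lti; elim: j => [|j IH] lej; first by rewrite H0.
have := HV _ _ lti lej; case eH: (H i j) => [r|].
  by case: (IH (ltnW lej)) => [|k ltk pk]; rewrite ?eH // => _ _; exists k => //; apply: ltnW.
by case/irule_None_out=> [->|pij] // _; exists j.
Qed.

(** A point needs an empty label below it, but above a point the labels of the column stay
    nonempty. *)
Lemma growth_point_uniq n p H V i j k : growth n p H V -> i < n -> j < k -> k < n ->
  p i j -> p i k -> False.
Proof.
case=> H0 _ HV lti ltjk ltk pij.
have E l : l < n -> j < l -> H i l <> None.
  elim: l => // l IH ltl; rewrite ltnS leq_eqVlt => /orP[/eqP<-|ltjl].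
    by have := HV i j lti; rewrite pij => /(_ (ltn_trans ltjk ltk)) /irule_point[_ _ ->].
  move: (IH (ltnW ltl) ltjl) (HV i l lti (ltnW ltl)).
  by case: (H i l) => // r _ /irule_Some_out.
move=> pik; have := HV _ _ lti ltk; rewrite pik => /irule_point[eH _ _ _].
exact: (E k).
Qed.

(** * Row insertion as a column of a growth diagram *)

(** The vertical label at height [v]: the row where the entries up to [v] exceed those below [v]. *)
Fixpoint rowof (T : tableau) (v : nat) : label :=
  if T is r :: T' then if v \in r then Some 0 else omap succn (rowof T' v)
  else None.

Lemma rowof_None T v : v \notin flatten T -> rowof T v = None.
Proof.
by elim: T => //= r T IH; rewrite mem_cat negb_or => /andP[/negbTE-> /IH->].
Qed.

(* The label crossing the horizontal line at height j while x is inserted. *)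
Fixpoint insert_label (T : tableau) (x j : nat) : label :=
  if T is r :: T' then
    let i := find (fun y => x < y) r in
    if j <= x then None
    else if (i < size r) && (nth 0 r i < j) then
      omap succn (insert_label T' (nth 0 r i) j)
    else Some 0
  else if j <= x then None else Some 0.

Lemma sorted_split r x : sorted ltn r -> x \notin r ->
  exists r1 r2, [/\ r = r1 ++ r2, all (ltn^~ x) r1, all (ltn x) r2
    & find (fun y => x < y) r = size r1].
Proof.
elim: r => [|y r IH] /=; first by exists [::], [::].
rewrite inE negb_or => sr /andP[neq nin].
have [ltxy|leyx] := ltnP x y.
  exists [::], (y :: r); split=> //=; rewrite ltxy /=.
  by apply/allP=> z /(allP (order_path_min ltn_trans sr)); apply: ltn_trans.
have [r1 [r2 [-> h1 h2 ->]]] := IH (path_sorted sr) nin.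
by exists (y :: r1), r2; split=> //=; rewrite h1 andbT; lia.
Qed.

Variant row_insert_spec (r : seq nat) (x : nat) : nat -> seq nat -> Prop :=
| RowAppend r1 of r = r1 & all (ltn^~ x) r1 :
    row_insert_spec r x (size r) (rcons r1 x)
| RowBump r1 y r2 of r = r1 ++ y :: r2 & all (ltn^~ x) r1 & all (ltn y) r2
    & x < y & nth 0 r (size r1) = y & size r1 < size r :
    row_insert_spec r x (size r1) (r1 ++ x :: r2).

Lemma row_insertP r x : sorted ltn r -> x \notin r ->
  let i := find (fun y => x < y) r in row_insert_spec r x i (set_nth 0 r i x).
Proof.
move=> sr nin; have [r1 [[|y r2] [er h1 h2 ->]]] /= := sorted_split sr nin.
  rewrite cats0 in er; subst r1.
  by rewrite set_nthE ltnn subnn /= cats1; constructor.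
have lt: size r1 < size r by rewrite er size_cat /=; lia.
rewrite set_nthE lt {2 3}er take_size_cat // drop_cat ltnNge leqnSn /= subSnn /= drop0.
have /andP[ltxy _] := h2.
apply: (@RowBump _ _ _ y) => //; last by rewrite er nth_cat ltnn subnn.
by move: sr; rewrite er => /cat_sorted2[_ /(order_path_min ltn_trans)].
Qed.

Definition tab_ok (T : tableau) := all (sorted ltn) T && uniq (flatten T).

Lemma sorted_append r1 x : sorted ltn r1 -> all (ltn^~ x) r1 -> sorted ltn (rcons r1 x).
Proof.
rewrite !(sorted_pairwise ltn_trans) pairwise_rcons => -> h; rewrite andbT.
exact: h.
Qed.

Lemma sorted_bump r1 x y r2 : sorted ltn (r1 ++ y :: r2) -> all (ltn^~ x) r1 ->
  x < y -> sorted ltn (r1 ++ x :: r2).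
Proof.
rewrite !(sorted_pairwise ltn_trans) !pairwise_cat /= => /and3P[h1 -> /andP[h2 ->]] h ltxy.
rewrite !andbT; apply/andP; split.
  apply/allrelP=> a b /[dup] ain1 /(allP h) ltax; rewrite inE => /orP[/eqP->//|bin].
  by apply: (allrelP h1); rewrite // inE bin orbT.
by apply/allP=> z /(allP h2); apply: ltn_trans.
Qed.

Lemma perm_flatten_insert T x : tab_ok T -> x \notin flatten T ->
  perm_eq (flatten (rs_insert T x).1) (x :: flatten T) /\
  all (sorted ltn) (rs_insert T x).1.
Proof.
elim: T x => [|r T IH] x //= /andP[/= /andP[sr sT]].
rewrite cat_uniq mem_cat negb_or => /and3P[ur nrT uT] /andP[nxr nxT].
case: (row_insertP sr nxr) => [r1 er h1|r1 y r2 er h1 h2 ltxy -> ->] /=.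
  rewrite ltnn /=; subst r1; rewrite sT andbT; split; last exact: sorted_append.
  by rewrite -cats1 -catA perm_catCA.
have nyT: y \notin flatten T.
  by apply: contra nrT => yT; apply/hasP; exists y => //; rewrite er mem_cat inE eqxx orbT.
have [|IH1 IH2] := IH y _ nyT; first by rewrite /tab_ok sT.
rewrite er in sr; rewrite IH2 (sorted_bump sr) //; split=> //.
apply/seq.permP => a; rewrite er /= !count_cat /= (seq.permP IH1) /=.
by rewrite !addnA; congr (_ + _); rewrite [a x + _]addnC -!addnA [_ + a y]addnC.
Qed.

Lemma tab_ok_insert T x : tab_ok T -> x \notin flatten T -> tab_ok (rs_insert T x).1.
Proof.
move=> ok nin; have [pe s] := perm_flatten_insert ok nin.
by rewrite /tab_ok s (perm_uniq pe) /= nin; case/andP: ok.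
Qed.

Lemma insert_label_le T x j : j <= x -> insert_label T x j = None.
Proof. by case: T => [|r T] /= ->. Qed.

(** Inserting [x] is a column with its point at height [x] and with [rowof] before and after as
    vertical labels. Induction on rows: an entry [y] bumped from the first row is the point of the
    column for the rows below. *)
Lemma insert_irule T x j : tab_ok T -> x \notin flatten T ->
  irule (insert_label T x j.+1) (rowof (rs_insert T x).1 j) =
  (j == x, (insert_label T x j, rowof T j)).
Proof.
elim: T x => [|r T IH] x /=.
  by move=> _ _; rewrite inE; case: (ltngtP j x).
case/andP=> /= /andP[sr sT].
rewrite cat_uniq mem_cat negb_or => /and3P[ur nrT uT] /andP[nxr nxT].
case: (row_insertP sr nxr) => [r1 er h1|r1 y r2 er h1 h2 ltxy -> lts] /=.
  rewrite ltnn /= mem_rcons inE -er; case: (ltngtP j x) => [lt|lt|->] /=.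
  - by rewrite irule_None.
  - have /negbTE->: j \notin r.
      by apply: contraL lt; rewrite er => /(allP h1) /= ltjx; rewrite -leqNgt ltnW.
    by case: (rowof T j).
  - by rewrite (negbTE nxr) rowof_None.
rewrite lts /=.
have nyT: y \notin flatten T.
  by apply: contra nrT => yT; apply/hasP; exists y => //; rewrite er mem_cat inE eqxx orbT.
have ok: tab_ok T by rewrite /tab_ok sT.
move: {IH}(IH y ok nyT) => IH.
have memE: (j \in r1 ++ x :: r2) = (j == x) || ((j \in r) && (j != y)).
  rewrite er !mem_cat !inE; case: (j =P y) => [->|]; last by rewrite andbT => _; case: (j \in r1); rewrite ?orbT.
  rewrite andbF orbF.
  have /negbTE->: y \notin r1.
    by apply/negP=> /(allP h1) /= /ltnW; rewrite leqNgt ltxy.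
  have /negbTE->: y \notin r2 by apply/negP=> /(allP h2) /=; rewrite ltnn.
  by rewrite orbF.
have between: x < j < y -> j \notin r.
  case/andP=> ltxj ltjy; rewrite er mem_cat inE.
  apply/negP=> /or3P[/(allP h1) /= ltjx|/eqP ejy|/(allP h2) /= ltyj].
  - by move: (ltn_trans ltxj ltjx); rewrite ltnn.
  - by move: ltjy; rewrite ejy ltnn.
  - by move: (ltn_trans ltyj ltjy); rewrite ltnn.
have yr: y \in r by rewrite er mem_cat inE eqxx orbT.
rewrite memE; case: (ltngtP j x) => [ltjx|ltxj|->] /=.
- rewrite irule_None.
  have ltjy := ltn_trans ltjx ltxy.
  rewrite (ltn_eqF ltjy) andbT; case: (j \in r) => //.
  by move: IH; rewrite !insert_label_le ?(ltnW ltjy) // irule_None => -[_ ->].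
- rewrite ltnS; case: (ltngtP j y) => [ltjy|ltyj|ejy] /=.
  + rewrite (negbTE (between _)) ?ltxj //=.
    move: IH; rewrite !insert_label_le ?(ltnW ltjy) // irule_None => -[_ ->].
    by case: (rowof T j).
  + rewrite andbT; have ne := gtn_eqF ltyj.
    have [jr|jr] := boolP (j \in r); last by apply: irule_shift; rewrite IH ne.
    have jT: j \notin flatten T by apply: contra nrT => jT; apply/hasP; exists j.
    have jT': j \notin flatten (rs_insert T y).1.
      by rewrite (perm_mem (perm_flatten_insert ok nyT).1) inE ne.
    move: IH; rewrite !rowof_None // ne.
    by case: (insert_label T y j.+1) => [l|] [<-].
  (* At height [y] the point of the lower rows becomes a square with bottom and left labels
     [Some 0]: [y] moves from the first row to the second. *)
  + subst j; rewrite andbF yr /=.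
    by move: IH; rewrite eqxx => /irule_point[_ _ -> ->].
- by rewrite (negbTE nxr) rowof_None // ltnNge ltxy.
Qed.

(** Above all entries the label is the row of the new cell, so the top border is the recording
    word. *)
Lemma insert_label_top T x n : tab_ok T -> x \notin flatten T ->
  all (ltn^~ n) (x :: flatten T) -> insert_label T x n = Some (rs_insert T x).2.
Proof.
elim: T x => [|r T IH] x /=.
  by move=> _ _; rewrite andbT ltnNge => /negbTE->.
case/andP=> /= /andP[sr sT].
rewrite cat_uniq mem_cat negb_or => /and3P[ur nrT uT] /andP[nxr nxT].
rewrite all_cat => /and3P[ltxn hr hT].
rewrite leqNgt ltxn /=.
case: (row_insertP sr nxr) => [r1 er h1|r1 y r2 er h1 h2 ltxy -> lts] /=.
  by rewrite ltnn.
have yr: y \in r by rewrite er mem_cat inE eqxx orbT.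
have nyT: y \notin flatten T by apply: contra nrT => yT; apply/hasP; exists y.
have ltyn := allP hr _ yr.
by rewrite lts ltyn /= IH //= ?hT ?andbT // /tab_ok sT.
Qed.

(** * Words and their recording words *)

Definition insert_word (T : tableau) (w : seq nat) : tableau :=
  foldl (fun T x => (rs_insert T x).1) T w.

(** From the empty tableau, letter [i] is the row of entry [i] in the recording tableau, so the word
    encodes that tableau. *)
Fixpoint rec_word (T : tableau) (w : seq nat) : seq nat :=
  if w is x :: w' then
    (rs_insert T x).2 :: rec_word (rs_insert T x).1 w'
  else [::].

Lemma size_rec_word T w : size (rec_word T w) = size w.
Proof. by elim: w T => //= x w IH T; rewrite IH. Qed.

Lemma nth_rec_word T w i : i < size w ->
  nth 0 (rec_word T w) i = (rs_insert (insert_word T (take i w)) (nth 0 w i)).2.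
Proof. by elim: w T i => // x w IH T [|i] //= lti; rewrite IH. Qed.

Lemma insert_word_take T w i : i < size w ->
  insert_word T (take i.+1 w) =
  (rs_insert (insert_word T (take i w)) (nth 0 w i)).1.
Proof. by move=> lti; rewrite (take_nth 0) // /insert_word foldl_rcons. Qed.

Lemma insert_word_ok w : uniq w ->
  tab_ok (insert_word [::] w) /\ perm_eq (flatten (insert_word [::] w)) w.
Proof.
elim/last_ind: w => // w x IH; rewrite rcons_uniq => /andP[nx uw].
have [ok pe] := IH uw.
rewrite /insert_word foldl_rcons -/(insert_word [::] w).
have nin: x \notin flatten (insert_word [::] w) by rewrite (perm_mem pe).
split; first exact: tab_ok_insert.
by rewrite (permPl (perm_flatten_insert ok nin).1) perm_sym perm_rcons perm_cons perm_sym.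
Qed.

Lemma growth_word n (w : seq nat) : uniq w -> size w = n -> all (ltn^~ n) w ->
  exists H V, growth n (fun i j => nth 0 w i == j) H V /\
    forall i, i < n -> H i n = Some (nth 0 (rec_word [::] w) i).
Proof.
move=> uw sw hw; pose P i := insert_word [::] (take i w).
have okP i : tab_ok (P i) /\ perm_eq (flatten (P i)) (take i w).
  by apply: insert_word_ok; apply: take_uniq.
have nin i : i < n -> nth 0 w i \notin flatten (P i).
  move=> lti; rewrite (perm_mem (okP i).2).
  move: uw; rewrite -{1}(cat_take_drop i w) cat_uniq (drop_nth 0) ?sw //=.
  by case/and3P=> _; rewrite negb_or => /andP[].
exists (fun i => insert_label (P i) (nth 0 w i)), (fun i => rowof (P i)).
split; first split=> [i lti|j _|i j lti ltj].
- by rewrite insert_label_le.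
- by rewrite /P take0.
- rewrite eq_sym -insert_irule; [|exact: (okP i).1|exact: nin].
  by rewrite /P insert_word_take // sw.
move=> i lti; rewrite nth_rec_word ?sw //; apply: insert_label_top.
- exact: (okP i).1.
- exact: nin.
apply/allP=> z; rewrite inE (perm_mem (okP i).2) => /orP[/eqP->|/mem_take];
  apply: (allP hw).
by rewrite mem_nth ?sw.
Qed.

(** * Shapes as letter counts of recording words *)

Lemma nth_shape_add T i m r :
  nth 0 (shape (add_to_row T i m)) r = nth 0 (shape T) r + (i == r).
Proof.
have E U : nth 0 (shape U) r = size (nth [::] U r).
  have [lt|le] := ltnP r (size U); first by rewrite (nth_map [::]).
  by rewrite !nth_default ?size_map.
rewrite !E /add_to_row nth_set_nth /= [r == i]eq_sym; case: eqP => [->|_].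
  by rewrite size_rcons addn1.
by rewrite addn0.
Qed.

Lemma RS_words n (s : 'S_n) (e : seq 'I_n) PQ :
  let w := [seq nat_of_ord (s i) | i <- e] in
  (foldl (rs_step s) PQ e).1 = insert_word PQ.1 w /\
  forall r, nth 0 (shape (foldl (rs_step s) PQ e).2) r =
            nth 0 (shape PQ.2) r + count_mem r (rec_word PQ.1 w).
Proof.
elim: e PQ => [|i e IH] PQ /=; first by split=> // r; rewrite addn0.
have [-> E] := IH (rs_step s PQ i); split=> // r.
by rewrite E nth_shape_add addnA.
Qed.

Definition pword n (s : 'S_n) := [seq nat_of_ord (s i) | i <- enum 'I_n].

Definition rword n (s : 'S_n) := rec_word [::] (pword s).

Lemma size_rword n (s : 'S_n) : size (rword s) = n.
Proof. by rewrite size_rec_word size_map size_enum_ord. Qed.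

Lemma nth_sh n (s : 'S_n) r : nth 0 (sh s) r = count_mem r (rword s).
Proof.
rewrite /sh shape_RS /RS; have [_ ->] := RS_words s (enum 'I_n) ([::], [::]).
by rewrite nth_nil.
Qed.

Lemma rs_insert_neq0 T x : [::] \notin T -> [::] \notin (rs_insert T x).1.
Proof.
elim: T x => //= r T IH x; rewrite inE negb_or => /andP[ner neT].
have ne: [::] != set_nth 0 r (find (fun y => x < y) r) x.
  by rewrite -[_ == _]/(_ == _) eq_sym -size_eq0 size_set_nth; lia.
by case: ifP => _ /=; rewrite inE negb_or ne //= IH.
Qed.

Lemma sh_gt0 n (s : 'S_n) : 0 \notin sh s.
Proof.
rewrite /sh /RS (RS_words s (enum 'I_n) ([::], [::])).1 /=.
set w := map _ _.
have: [::] \notin insert_word [::] w.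
  elim/last_ind: w => // w x IH; rewrite /insert_word foldl_rcons.
  exact: rs_insert_neq0.
by apply: contra => /mapP[t tin /esym/size0nil <-].
Qed.

(** A zero-free sequence ends where [nth] first returns the default [0]. *)
Lemma eq_nth_gt0 (a b : seq nat) : 0 \notin a -> 0 \notin b ->
  nth 0 a =1 nth 0 b -> a = b.
Proof.
move=> a0 b0 E; apply: (@eq_from_nth _ 0) => [|i _]; last exact: E.
have H (c d : seq nat) : 0 \notin c -> nth 0 c =1 nth 0 d -> size c <= size d.
  move=> c0 Ecd; rewrite leqNgt; apply: contra c0 => lt.
  by rewrite -(nth_default 0 (leqnn (size d))) -Ecd mem_nth.
by apply/eqP; rewrite eqn_leq !H // => i; rewrite E.
Qed.

Lemma sh_eqP n (s t : 'S_n) :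
  sh s = sh t <-> forall r, count_mem r (rword s) = count_mem r (rword t).
Proof.
split=> [E r|E]; first by rewrite -!nth_sh E.
by apply: eq_nth_gt0; rewrite ?sh_gt0 // => r; rewrite !nth_sh.
Qed.

(** * The growth diagram of a permutation *)

Definition point n (s : 'S_n) (i j : nat) := nth 0 (pword s) i == j.

Lemma nth_pword n (s : 'S_n) (i : 'I_n) : nth 0 (pword s) i = s i.
Proof. by rewrite (nth_map i) ?size_enum_ord // nth_ord_enum. Qed.

Lemma pointE n (s : 'S_n) (i j : 'I_n) : point s i j = (s i == j).
Proof. by rewrite /point nth_pword. Qed.

Lemma point_inv n (s : 'S_n) i j : i < n -> j < n -> point s^-1 j i = point s i j.
Proof.
move=> lti ltj; rewrite (pointE s (Ordinal lti) (Ordinal ltj)).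
rewrite (pointE s^-1 (Ordinal ltj) (Ordinal lti)).
by rewrite -(inj_eq (@perm_inj _ s)) permKV eq_sym.
Qed.

Lemma growth_rword n (s : 'S_n) : exists H V, growth n (point s) H V /\
  forall i, i < n -> H i n = Some (nth 0 (rword s) i).
Proof.
apply: growth_word; last 1 first.
- by apply/allP=> _ /mapP[i _ ->] /=.
- by rewrite map_inj_uniq ?enum_uniq // => i j /val_inj /perm_inj.
- by rewrite size_map size_enum_ord.
Qed.

Lemma growth_top n (s : 'S_n) p H V : growth n p H V ->
  (forall i j, i < n -> j < n -> p i j = point s i j) ->
  forall i, i < n -> H i n = Some (nth 0 (rword s) i).
Proof.
move=> g E i lti; have [H' [V' [g' <-]]] := growth_rword s => //.
exact: (growth_uniq g g' E).
Qed.

(** The transposed diagram has the points of [s^-1], and its top border is the right border here. *)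
Lemma growth_right n (s : 'S_n) p H V : growth n p H V ->
  (forall i j, i < n -> j < n -> p i j = point s i j) ->
  forall j, j < n -> V n j = Some (nth 0 (rword s^-1) j).
Proof.
move=> g E; apply: (growth_top (growth_sym g)) => i j lti ltj.
by rewrite E // point_inv.
Qed.

Lemma eq_rword n (s t : 'S_n) :
  (forall i, i < n -> nth 0 (rword s) i = nth 0 (rword t) i) -> rword s = rword t.
Proof. by move=> E; apply: (@eq_from_nth _ 0); rewrite !size_rword. Qed.

Lemma rword_inj n (s t : 'S_n) :
  rword s = rword t -> rword s^-1 = rword t^-1 -> s = t.
Proof.
move=> E E'; have [H [V [g gH]]] := growth_rword s.
have [H' [V' [g' gH']]] := growth_rword t.
have gV := growth_right g (fun _ _ _ _ => erefl).
have gV' := growth_right g' (fun _ _ _ _ => erefl).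
apply/permP => i; apply/val_inj/eqP => /=.
rewrite -(nth_pword s) -/(point s i (t i)).
rewrite (growth_border_inj g g') ?pointE //.
- by move=> k ltk; rewrite gH // gH' // E.
- by move=> k ltk; rewrite gV // gV' // E'.
Qed.

Lemma hsum_top n (s : 'S_n) H i r : i <= n ->
  (forall i, i < n -> H i n = Some (nth 0 (rword s) i)) ->
  hsum H i n r = count_mem r (take i (rword s)).
Proof.
move=> + Hn; elim: i => [|i IH] lei; first by rewrite hsum0 take0.
rewrite hsumS IH 1?ltnW // Hn // (take_nth 0) ?size_rword //.
by rewrite -cats1 count_cat /= addn0.
Qed.

Lemma sh_inv n (s : 'S_n) : sh s^-1 = sh s.
Proof.
have [H [V [g gH]]] := growth_rword s.
have gV := growth_right g (fun _ _ _ _ => erefl).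
apply/sh_eqP => r.
rewrite -[in RHS](take_oversize (eq_leq (size_rword s))) -(hsum_top _ _ gH) //.
rewrite (growth_hsum_vsum _ g) //.
by rewrite (@hsum_top _ s^-1) // take_oversize ?size_rword.
Qed.

(** * Surjectivity of the Robinson-Schensted correspondence *)

(** The words of [s] and [t] are placed on the top and right borders; equal shapes make them agree
    in the corner, so [back_growth] applies. *)
Lemma glue_exists n (s t : 'S_n) : sh s = sh t ->
  exists x : 'S_n, rword x = rword s /\ rword x^-1 = rword t.
Proof.
move/sh_eqP => E.
have [H [V [g gH]]] := growth_rword s.
have [H' [V' [g' gH']]] := growth_rword t.
pose u i := H i n; pose v j := H' j n.
have gb: growth n (backp u v n) (backH u v n) (backV u v n).
  apply: (@back_growth _ _ _ (fun i => hsum H i n) (fun j => hsum H' j n)).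
  - by move=> i lei; apply: (growth_part g).
  - by move=> i lei; apply: (growth_part g').
  - by move=> r; rewrite hsum0.
  - by move=> r; rewrite hsum0.
  - by move=> i r _; rewrite hsumS.
  - by move=> i r _; rewrite hsumS.
  - move=> r; rewrite (hsum_top _ _ gH) // (hsum_top _ _ gH') //.
    by rewrite !take_oversize ?size_rword.
have bH i : backH u v n i n = u i by rewrite /backH subnn.
have bV j : backV u v n n j = v j by rewrite /backV subnn.
move: (backp u v n) (backH u v n) (backV u v n) gb bH bV => p X Y gb bH bV.
(* All top labels are nonempty, so each column has a point; since no row has two, the choice [f] is
   injective. *)
have ex (i : 'I_n) : exists j : 'I_n, p i j.
  have [|k ltk pk] := growth_no_point gb (ltn_ord i) (leqnn n).
    by rewrite bH /u gH.
  by exists (Ordinal ltk).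
pose f (i : 'I_n) := xchoose (ex i).
have pf (i : 'I_n) : p i (f i) := xchooseP (ex i).
have f_inj : injective f.
  move=> i k eq_f; apply/val_inj; case: (ltngtP i k) => // lt; exfalso.
    apply: (growth_point_uniq (growth_sym gb) (ltn_ord (f i)) lt _ (pf i)) => //.
    by rewrite eq_f.
  apply: (growth_point_uniq (growth_sym gb) (ltn_ord (f i)) lt _ _ (pf i)) => //.
  by rewrite eq_f.
exists (perm f_inj).
(* No column has two points, so [p] has no points besides those of [f]. *)
have px i j : i < n -> j < n -> p i j = point (perm f_inj) i j.
  move=> lti ltj; rewrite (pointE _ (Ordinal lti) (Ordinal ltj)) permE.
  have pi := pf (Ordinal lti).
  apply/idP/eqP => [pij|e]; last by move: pi; rewrite e.
  apply/val_inj; case: (ltngtP (f (Ordinal lti)) (Ordinal ltj)) => // lt; exfalso.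
    exact: (growth_point_uniq gb lti lt).
  exact: (growth_point_uniq gb lti lt).
split; apply: eq_rword => i lti; apply: Some_inj.
  by rewrite -(growth_top gb px lti) bH /u gH.
by rewrite -(growth_right gb px lti) bV /v gH'.
Qed.

(** * Schensted's theorem on longest increasing subsequences *)

Definition in_box n (s : 'S_n) (i j : nat) (A : {set 'I_n}) :=
  [forall a in A, (a < i) && (s a < j)].

Definition lis_box n (s : 'S_n) (i j : nat) :=
  \max_(A : {set 'I_n} | incr_on s A && in_box s i j A) #|A|.

Lemma incr_onP n (s : 'S_n) (A : {set 'I_n}) :
  reflect {in A &, forall a b : 'I_n, a < b -> s a < s b} (incr_on s A).
Proof.
apply: (iffP forall_inP) => [h a b /h/forall_inP hb /hb /implyP //|h a ain].
by apply/forall_inP=> b bin; apply/implyP; apply: h.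
Qed.

Lemma in_boxP n (s : 'S_n) i j (A : {set 'I_n}) :
  reflect {in A, forall a : 'I_n, a < i /\ s a < j} (in_box s i j A).
Proof.
by apply: (iffP forall_inP) => h a /h; [move/andP | case=> -> ->].
Qed.

Lemma lis_box_full n (s : 'S_n) : lis s = lis_box s n n.
Proof.
apply: eq_bigl => A; suff -> : in_box s n n A by rewrite andbT.
by apply/in_boxP => a _; rewrite !ltn_ord.
Qed.

Lemma lis_box_le n (s : 'S_n) i j i' j' : i <= i' -> j <= j' ->
  lis_box s i j <= lis_box s i' j'.
Proof.
move=> lei lej; apply/bigmax_leqP => A /andP[iA /in_boxP bA].
apply: (@leq_bigmax_cond _ _ (fun A : {set 'I_n} => #|A|)); rewrite iA /=.
by apply/in_boxP=> a /bA[]; split; [apply: leq_trans lei | apply: leq_trans lej].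
Qed.

Lemma lis_box_empty n (s : 'S_n) i j : (i == 0) || (j == 0) -> lis_box s i j = 0.
Proof.
move=> ij0; apply/eqP; rewrite -leqn0; apply/bigmax_leqP => A /andP[_ /in_boxP bA].
rewrite leqn0 cards_eq0; apply/eqP/setP => a; rewrite inE; apply/negP => /bA[].
by case/orP: ij0 => /eqP->.
Qed.

(** The point in the upper right square extends every increasing subsequence of the smaller box;
    removing it from a subsequence that uses it leaves that box. *)
Lemma lis_box_point n (s : 'S_n) i j : i < n -> j < n -> point s i j ->
  lis_box s i.+1 j.+1 = (lis_box s i j).+1.
Proof.
move=> lti ltj; set a := Ordinal lti.
rewrite (pointE s a (Ordinal ltj)) => /eqP eqj; have sa : s a = j :> nat by rewrite eqj.
apply/eqP; rewrite eqn_leq; apply/andP; split.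
  apply/bigmax_leqP => A /andP[/incr_onP iA /in_boxP bA].
  have [ain|anin] := boolP (a \in A); last first.
    apply: leqW; apply: (@leq_bigmax_cond _ _ (fun A : {set 'I_n} => #|A|)).
    apply/andP; split; first exact/incr_onP.
    apply/in_boxP=> b bin; have [ltb ltsb] := bA _ bin.
    have neq: b != a by apply: contraNneq anin => <-.
    have nesb: s b != s a by rewrite (inj_eq perm_inj).
    by move: neq nesb ltb ltsb; rewrite -!val_eqE /= sa; split; lia.
  rewrite (cardsD1 a) ain add1n ltnS.
  apply: (@leq_bigmax_cond _ _ (fun A : {set 'I_n} => #|A|)); apply/andP; split.
    by apply/incr_onP=> b c /setD1P[_ +] /setD1P[_ +]; apply: iA.
  apply/in_boxP=> b /setD1P[neq bin]; have [ltb _] := bA _ bin.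
  have ltba : b < a by move: neq ltb; rewrite -val_eqE /=; lia.
  by split=> //; rewrite -sa; apply: iA.
have [|A + eA] :=
    @eq_bigmax_cond _ [pred A | incr_on s A && in_box s i j A] (fun A : {set 'I_n} => #|A|).
  apply/card_gt0P; exists set0; rewrite inE; apply/andP; split.
    by apply/incr_onP=> b; rewrite inE.
  by apply/in_boxP=> b; rewrite inE.
rewrite inE => /andP[/incr_onP iA /in_boxP bA]; rewrite [lis_box s i j]eA.
have anin: a \notin A by apply/negP => /bA[]; rewrite ltnn.
have -> : #|A|.+1 = #|a |: A| by rewrite cardsU1 anin.
apply: (@leq_bigmax_cond _ _ (fun A : {set 'I_n} => #|A|)); apply/andP; split.
  apply/incr_onP=> b c /setU1P[->|bin] /setU1P[->|cin]; first by rewrite ltnn.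
  - by move/(ltn_trans (bA _ cin).1); rewrite ltnn.
  - by move=> _; rewrite sa; have [] := bA _ bin.
  - exact: iA.
apply/in_boxP=> b /setU1P[->|/bA[]]; first by rewrite sa.
by split; apply: ltnW.
Qed.

(** A subsequence using position [i] ends there with a value below [j], so all its values are below
    [j]; any other one stays left of position [i]. *)
Lemma lis_box_nopoint n (s : 'S_n) i j : i < n -> j < n -> ~~ point s i j ->
  lis_box s i.+1 j.+1 = maxn (lis_box s i.+1 j) (lis_box s i j.+1).
Proof.
move=> lti ltj; set a := Ordinal lti.
rewrite (pointE s a (Ordinal ltj)) => nej.
apply/eqP; rewrite eqn_leq geq_max !lis_box_le // ?andbT.
apply/bigmax_leqP => A /andP[/incr_onP iA /in_boxP bA]; rewrite leq_max.
have [ain|anin] := boolP (a \in A); apply/orP; [left|right];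
  apply: (@leq_bigmax_cond _ _ (fun A : {set 'I_n} => #|A|));
  (apply/andP; split; first exact/incr_onP); apply/in_boxP=> b bin;
  have [ltb ltsb] := bA _ bin; split=> //.
  have [_ ltsa] := bA _ ain.
  have {nej ltsa}ltsa : s a < j by move: nej; rewrite -val_eqE /=; lia.
  have [eqab|neq] := eqVneq b a; first by rewrite eqab.
  apply: ltn_trans ltsa; apply: iA => //.
  by move: neq ltb; rewrite -val_eqE /=; lia.
have neq: b != a by apply: contraNneq anin => <-.
by move: neq ltb; rewrite -val_eqE /=; lia.
Qed.

Lemma lis_sh n (s : 'S_n) : lis s = head 0 (sh s).
Proof.
have [H [V [g gH]]] := growth_rword s.
have E i j : i <= n -> j <= n -> lis_box s i j = hsum H i j 0.
  elim: i j => [|i IHi] j lei; first by rewrite lis_box_empty ?hsum0.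
  elim: j => [|j IHj] lej; first by rewrite lis_box_empty ?orbT ?(growth_hsum_bot _ g).
  have [pij|pij] := boolP (point s i j).
    by rewrite lis_box_point // (growth_point_hsum0 g) // IHi 1?ltnW.
  rewrite lis_box_nopoint // (growth_nopoint_hsum0 g) // IHj 1?ltnW //.
  by rewrite IHi // ltnW.
rewrite lis_box_full E // (hsum_top _ _ gH) // take_oversize ?size_rword //.
by rewrite -nth0 nth_sh.
Qed.

(** * Gluing and involutions *)

(** The default [s] is returned only if no permutation has both words, which [glueP] excludes for
    equal shapes. *)
Definition glue n (s t : 'S_n) : 'S_n :=
  odflt s [pick x | (rword x == rword s) && (rword x^-1 == rword t)].

Lemma glueP n (s t : 'S_n) : sh s = sh t ->
  rword (glue s t) = rword s /\ rword (glue s t)^-1 = rword t.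
Proof.
move/glue_exists=> [x [/eqP e1 /eqP e2]]; rewrite /glue.
by case: pickP => [y /andP[/eqP-> /eqP->]//|/(_ x)]; rewrite e1 e2.
Qed.

Lemma sh_rword n (s t : 'S_n) : rword s = rword t -> sh s = sh t.
Proof. by move=> E; apply/sh_eqP; rewrite E. Qed.

Lemma sh_glue n (s t : 'S_n) : sh s = sh t -> sh (glue s t) = sh s.
Proof. by case/glueP=> e _; apply: sh_rword. Qed.

Definition diag n (s : 'S_n) := glue s s.

Lemma rword_diag n (s : 'S_n) : rword (diag s) = rword s.
Proof. by have [] := glueP (erefl (sh s)). Qed.

Lemma invol_rwordV n (s : 'S_n) : (s * s)%g = 1%g -> rword s^-1 = rword s.
Proof. by move/eqP; rewrite -eq_invg_mul => /eqP->. Qed.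

(** Inversion exchanges the two words, which coincide here, so [diag s] is its own inverse. *)
Lemma diag_invol n (s : 'S_n) : (diag s * diag s == 1)%g.
Proof.
have [e1 e2] := glueP (erefl (sh s)).
rewrite -eq_invg_mul; apply/eqP; apply: rword_inj; rewrite ?invgK /diag.
  by rewrite e1 e2.
by rewrite e1 e2.
Qed.

Lemma invol_rword_inj n (s t : 'S_n) : (s * s)%g = 1%g -> (t * t)%g = 1%g ->
  rword s = rword t -> s = t.
Proof. by move=> s2 t2 e; apply: rword_inj; rewrite ?invol_rwordV. Qed.

Lemma diag_Ink n k (s : 'S_n) : s \in Lnk n k -> diag s \in Ink n k.
Proof.
by rewrite !inE diag_invol !lis_sh (sh_rword (rword_diag s)).
Qed.

Lemma Lnk_inv n k (s : 'S_n) : (s^-1%g \in Lnk n k) = (s \in Lnk n k).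
Proof. by rewrite !inE !lis_sh sh_inv. Qed.

(** * From pairs of involutions to pairs of permutations *)

Theorem theorem2p2 (n k : nat) (hn : 1 <= n) (hk1 : 1 <= k) (hkn : k <= n) :
  (exists f : 'S_n * 'S_n -> 'S_n * 'S_n,
     shape_preserving_injection
       (setX (Ink n (k - 1)) (Ink n (k + 1))) (setX (Ink n k) (Ink n k)) f) ->
  exists F : 'S_n * 'S_n -> 'S_n * 'S_n,
    shape_preserving_injection
      (setX (Lnk n (k - 1)) (Lnk n (k + 1))) (setX (Lnk n k) (Lnk n k)) F.
Proof.
case=> f [f_into f_inj f_sh].
set D := setX (Ink _ _) _ in f_into f_inj f_sh; set D' := setX (Lnk _ _) _.
pose P (p : 'S_n * 'S_n) := (diag p.1, diag p.2).
pose Q (p : 'S_n * 'S_n) := P (p.1^-1, p.2^-1)%g.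
have PD p : p \in D' -> P p \in D.
  by case: p => s t; rewrite !in_setX => /andP[hs ht]; rewrite !diag_Ink.
have QD p : p \in D' -> Q p \in D.
  by case: p => s t hp; apply: PD; move: hp; rewrite !in_setX /= !Lnk_inv.
have shP p : sh2 (P p) = sh2 p.
  by rewrite /sh2 /= !(sh_rword (rword_diag _)).
have shQ p : sh2 (Q p) = sh2 p by rewrite shP /sh2 /= !sh_inv.
have shf p : p \in D' -> sh2 (f (P p)) = sh2 (f (Q p)).
  by move=> hp; apply: f_sh; [exact: PD | exact: QD | rewrite shP shQ].
have [shf1 shf2] : (forall p, p \in D' -> sh (f (P p)).1 = sh (f (Q p)).1) /\
                   (forall p, p \in D' -> sh (f (P p)).2 = sh (f (Q p)).2).
  by split=> p /shf; rewrite /sh2 => -[].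
pose F p := (glue (f (P p)).1 (f (Q p)).1, glue (f (P p)).2 (f (Q p)).2).
have shF p : p \in D' -> sh2 (F p) = sh2 (f (P p)).
  by move=> hp; congr (_, _); apply: sh_glue; [apply: shf1 | apply: shf2].
exists F; split=> [p hp|p q hp hq eqF|p q hp hq eqs].
(* [lis] is the first row of the shape, so [shF] transfers membership from [f (P p)] to [F p]. *)
- move: (f_into _ (PD p hp)) (shF p hp); case: (f (P p)) => a b.
  rewrite !in_setX => /andP[/=]; rewrite !inE !lis_sh.
  by move=> /andP[_ ea] /andP[_ eb] [-> ->]; rewrite ea eb.
- have invf r : r \in D -> (((f r).1 * (f r).1 = 1) /\ ((f r).2 * (f r).2 = 1))%g.
    move=> /f_into; case: (f r) => a b; rewrite in_setX !inE /=.
    by case/andP=> /andP[/eqP-> _] /andP[/eqP-> _].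
  case: eqF => eq1 eq2.
  have [p1 p1'] := glueP (shf1 p hp); have [p2 p2'] := glueP (shf2 p hp).
  have [q1 q1'] := glueP (shf1 q hq); have [q2 q2'] := glueP (shf2 q hq).
  (* Involutions are determined by their recording words, so the words determine [f x], and
     injectivity of [f] gives [x]. *)
  have inj x y : x \in D -> y \in D -> rword (f x).1 = rword (f y).1 ->
      rword (f x).2 = rword (f y).2 -> x = y.
    move=> hx hy e1 e2; apply: f_inj => //.
    have [[x1 x2] [y1 y2]] := (invf x hx, invf y hy).
    rewrite [f x]surjective_pairing [f y]surjective_pairing.
    by rewrite (invol_rword_inj x1 y1 e1) (invol_rword_inj x2 y2 e2).
  have eP : P p = P q.
    by apply: inj; [exact: PD | exact: PD | rewrite -p1 -q1 eq1 | rewrite -p2 -q2 eq2].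
  have eQ : Q p = Q q.
    by apply: inj; [exact: QD | exact: QD | rewrite -p1' -q1' eq1 | rewrite -p2' -q2' eq2].
  (* [P] retains the recording words of both components and [Q] those of their inverses; together
     they determine the pair. *)
  case: p q eP eQ {eq1 eq2 p1 p1' p2 p2' q1 q1' q2 q2' hp hq} => [s t] [s' t'].
  have dE x y : diag x = diag y -> rword x = rword y.
    by move=> e; rewrite -(rword_diag x) e rword_diag.
  move=> [/dE es /dE et] [/dE es' /dE et'].
  by rewrite (rword_inj es es') (rword_inj et et').
- by rewrite !shF //; apply: f_sh; [exact: PD | exact: PD | rewrite !shP].
Qed.
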